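(* If $L$ is a Latin square of even order $n>2$, then $$E_1 + E_3 + \cdots + E_{n-1} \equiv E_2 + E_4 + \cdots + E_n \equiv n \pmod 4,$$ where the first sum is over all odd indices from $1$ to $n-1$ and the second is over all even indices from $2$ to $n$.
   Context: A Latin square of order $n$ is an $n\times n$ matrix with symbols from $[n]=\{1,\dots,n\}$ in which each symbol appears exactly once in each row and exactly once in each column. A diagonal of $L$ is a selection of $n$ entries (cells), exactly one from each row and exactly one from each column. $E_i=E_i(L)$ is the number of diagonals of $L$ on which exactly $i$ distinct symbols appear. *)

(* Defs.v *)
From mathcomp Require Import all_boot all_algebra.

Set Implicit Arguments.
Unset Strict Implicit.
Unset Printing Implicit Defensive.

(* The symbol set {1, ..., n} is represented by 'I_n = {0, ..., n-1}. *)
Definition latin_square (n : nat) (L : 'M['I_n]_n) : Prop :=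
  (forall i k : 'I_n, #|[set j : 'I_n | L i j == k]| = 1) /\
  (forall j k : 'I_n, #|[set i : 'I_n | L i j == k]| = 1).

(* Cells are pairs (row, column).  That a diagonal consists of exactly n cells
   is implied by its having exactly one cell in each row. *)
Definition diagonal (n : nat) (D : {set 'I_n * 'I_n}) : bool :=
  [forall i : 'I_n, #|[set c in D | c.1 == i]| == 1] &&
  [forall j : 'I_n, #|[set c in D | c.2 == j]| == 1].

Definition symbols_on (n : nat) (L : 'M['I_n]_n) (D : {set 'I_n * 'I_n}) :
    {set 'I_n} :=
  [set L c.1 c.2 | c in D].

Definition E (n : nat) (L : 'M['I_n]_n) (i : nat) : nat :=
  #|[set D : {set 'I_n * 'I_n} | diagonal D & #|symbols_on L D| == i]|.

(* Main.v *)
Require Import Defs.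
From mathcomp Require Import all_boot all_algebra.
From mathcomp Require Import fingroup perm zify ring.

Set Implicit Arguments.
Unset Strict Implicit.
Unset Printing Implicit Defensive.

Import GRing.Theory.

(** The two claims follow from [E_odd = n %[mod 4]], where [E_odd] counts the
    diagonals showing an odd number of symbols: there are [n`!] diagonals, a
    multiple of [4] since [n >= 4], and [- n] is congruent to [n] modulo [4] since
    [n] is even.

    Identify a diagonal with a permutation [s], and let [m s] be the number of
    symbols that [s] misses.  As [n] is even, [s] shows an odd number of symbols
    iff [m s] is odd, and the square of [m s] is [1] or [0] modulo [4] according
    to its parity.  Hence, modulo [4], [E_odd] is the sum of the [m s ^ 2], which
    counts the triples [(s, a, b)] such that [s] misses the symbols [a] and [b].
    Sort these triples by the pair [(a, b)]:
    - if [a = b], the permutations that miss [a] correspond to derangements by a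
      translation, so there are equally many of them for each [a], and their
      number is odd ([odd_derangements]);
    - if [a != b], their number is even ([even_missing2]), and the pairs [(a, b)]
      and [(b, a)] contribute the same amount, so together a multiple of [4].
    So [E_odd] is congruent to [n * d] with [d] odd, that is, to [n].

    Both parities come from the fact that a permanent equals the determinant
    over the field with two elements ([natr_card_perms]). *)

(** * Permanents modulo 2 *)

(** The left-hand side is the permanent of the 0-1 matrix of [T]; signs vanish in
    characteristic 2. *)
Lemma natr_card_perms (n : nat) (T : rel 'I_n) :
  (#|[set s : 'S_n | [forall i, T i (s i)]]|%:R
     = \det (\matrix_(i, j) (T i j)%:R) :> 'F_2)%R.
Proof.
rewrite cardsE -sum1_card natr_sum big_mkcond /=; apply: eq_bigr => s _.
rewrite unfold_in /= (_ : (-1 = 1 :> 'F_2)%R); last exact/eqP.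
rewrite expr1n mul1r.
under eq_bigr do rewrite mxE.
case: ifP => [/forallP Ts | /negbT].
  by rewrite big1 // => i _; rewrite Ts.
rewrite negb_forall => /existsP[i nTi].
by rewrite (bigD1 i) //= (negbTE nTi) mul0r.
Qed.

Lemma natrF2_eq0 (m : nat) : (m%:R == 0 :> 'F_2)%R = ~~ odd m.
Proof. by rewrite -(dvdn_pcharf (pchar_Fp (isT : prime 2))) dvdn2. Qed.

Lemma allones_sub1_sqr (R : comNzRingType) (n : nat) :
  (n%:R = 0 :> R -> 2%:R = 0 :> R ->
    (const_mx 1 - 1%:M) *m (const_mx 1 - 1%:M) = 1%:M :> 'M[R]_n)%R.
Proof.
move=> n0 two0; apply/matrixP => i j; rewrite !mxE.
pose d (i k : 'I_n) : R := ((i == k)%:R)%R.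
transitivity (\sum_(k < n) (1 - d i k - d k j + d i k * d k j))%R.
  by apply: eq_bigr => k _; rewrite !mxE -/(d i k) -/(d k j); ring.
have sumd (f : 'I_n -> R) : (\sum_(k < n) d i k * f k = f i)%R.
  rewrite (bigD1 i) //= /d eqxx mul1r big1 ?addr0 // => k.
  by rewrite eq_sym => /negbTE ->; rewrite mul0r.
rewrite !big_split /= !sumrN sumd sumr_const card_ord n0.
have -> : (\sum_(k < n) d i k = 1)%R.
  by rewrite -[RHS](sumd (fun=> 1%R)); apply: eq_bigr => k _; rewrite mulr1.
have -> : (\sum_(k < n) d k j = 1)%R.
  rewrite (bigD1 j) //= /d eqxx big1 ?addr0 // => k.
  by move=> /negbTE ->.
rewrite sub0r -opprD -(natrD _ 1 1) two0 oppr0 add0r /d.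
by case: (i == j).
Qed.

(** The number of derangements is the permanent of [J - I], where [J] is the
    all-ones matrix, and [(J - I)^2 = n J - 2 J + I = I] over the field with two
    elements. *)
Lemma odd_derangements (n : nat) :
  ~~ odd n -> odd #|[set s : 'S_n | [forall i, s i != i]]|.
Proof.
move=> n_even; apply/negPn; rewrite -natrF2_eq0.
rewrite (natr_card_perms (fun i j => j != i)).
have -> : (\matrix_(i, j) (j != i)%:R = const_mx 1 - 1%:M :> 'M['F_2]_n)%R.
  apply/matrixP => i j; rewrite !mxE eq_sym.
  by case: (i == j); rewrite /= ?subrr ?subr0.
set A := (const_mx 1 - 1%:M)%R.
have AA : (A *m A = 1%:M)%R.
  by apply: allones_sub1_sqr; apply/eqP; rewrite natrF2_eq0.
apply/negP => /eqP A0; have := congr1 determinant AA.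
by rewrite det_mulmx A0 mul0r det1 => /eqP; rewrite eq_sym oner_eq0.
Qed.

(** * Symbols missed by a permutation *)

Definition symbols_of (n : nat) (L : 'M['I_n]_n) (s : 'S_n) : {set 'I_n} :=
  [set L i (s i) | i : 'I_n].

Lemma notin_symbols_of (n : nat) (L : 'M['I_n]_n) (s : 'S_n) (a : 'I_n) :
  (a \notin symbols_of L s) = [forall i, L i (s i) != a].
Proof.
apply/idP/forallP => [nas i | nas].
  by apply: contraNneq nas => <-; apply: imset_f.
by apply/imsetP => -[i _ /eqP]; rewrite eq_sym (negbTE (nas i)).
Qed.

(** The cells that contain [a] form the graph of a permutation [t], and [s]
    misses [a] iff [s] followed by the inverse of [t] is a derangement. *)
Lemma card_missing1 (n : nat) (L : 'M['I_n]_n) (a : 'I_n) : latin_square L ->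
  #|[set s | a \notin symbols_of L s]|
    = #|[set s : 'S_n | [forall i, s i != i]]|.
Proof.
move=> hL.
have /fin_all_exists[f Lf] (i : 'I_n) :
    exists j, forall j', (L i j' == a) = (j' == j).
  have /eqP/cards1P[j Lij] := hL.1 i a; exists j => j'.
  by have /setP/(_ j') := Lij; rewrite !inE.
have f_inj : injective f.
  move=> i1 i2 eq_f; have /eqP/cards1P[i Li] := hL.2 (f i1) a.
  have Laf k : f k = f i1 -> k = i.
    move=> fk; have /setP/(_ k) := Li; rewrite !inE -fk Lf eqxx.
    by move/esym/eqP.
  by rewrite (Laf i1) // (Laf i2).
pose t := perm f_inj.
rewrite -!sum1_card (reindex_inj (mulIg t)) /=; apply: eq_bigl => s.
rewrite !inE notin_symbols_of; apply: eq_forallb => i.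
by rewrite Lf permM permE (inj_eq f_inj).
Qed.

(** The permutations counted are those supported on the cells that contain neither
    [a] nor [b].  Each column has [n - 2] such cells, so the sum of the rows
    of their 0-1 matrix is zero modulo 2. *)
Lemma even_missing2 (n : nat) (L : 'M['I_n]_n) (a b : 'I_n) :
  latin_square L -> ~~ odd n -> a != b ->
  ~~ odd #|[set s | (a \notin symbols_of L s) && (b \notin symbols_of L s)]|.
Proof.
move=> hL n_even neq_ab.
pose T (i j : 'I_n) := (L i j != a) && (L i j != b).
have -> : [set s | (a \notin symbols_of L s) && (b \notin symbols_of L s)]
    = [set s : 'S_n | [forall i, T i (s i)]].
  apply/setP => s; rewrite !inE !notin_symbols_of.
  apply/andP/forallP => [[/forallP na /forallP nb] i | nab].
    by rewrite /T na nb.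
  by split; apply/forallP => i; have /andP[] := nab i.
rewrite -natrF2_eq0 natr_card_perms; apply/det0P.
exists (const_mx 1)%R.
  apply/eqP => /matrixP/(_ ord0 a); rewrite !mxE.
  by apply/eqP.
apply/matrixP => i0 j; rewrite !mxE.
under eq_bigr do rewrite !mxE mul1r.
rewrite -natr_sum; apply/eqP; rewrite natrF2_eq0.
have -> : \sum_i T i j = #|~: ([set i | L i j == a] :|: [set i | L i j == b])|.
  rewrite -sum1_card [RHS]big_mkcond; apply: eq_bigr => i _.
  by rewrite !inE negb_or -/(T i j); case: (T i j).
have := cardsC ([set i | L i j == a] :|: [set i | L i j == b]).
rewrite cardsU !hL.2 (_ : _ :&: _ = set0) ?cards0 ?card_ord; first lia.
apply/setP => i; rewrite !inE; apply/negP => /andP[/eqP ->].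
by rewrite (negbTE neq_ab).
Qed.

(** * Diagonals as permutations *)

Definition perm_graph (n : nat) (s : 'S_n) : {set 'I_n * 'I_n} :=
  [set (i, s i) | i : 'I_n].

Lemma in_perm_graph (n : nat) (s : 'S_n) (c : 'I_n * 'I_n) :
  (c \in perm_graph s) = (c.2 == s c.1).
Proof.
apply/imsetP/eqP => [[i _ ->] // | c2].
by exists c.1; rewrite // -c2 -surjective_pairing.
Qed.

Lemma perm_graph_inj (n : nat) : injective (@perm_graph n).
Proof.
move=> s t /setP eq_st; apply/permP => i.
by have := eq_st (i, s i); rewrite !in_perm_graph eqxx => /esym/eqP.
Qed.

Lemma diagonalP (n : nat) (D : {set 'I_n * 'I_n}) :
  reflect (exists s, D = perm_graph s) (diagonal D).
Proof.
apply: (iffP andP) => [[/forallP Drow /forallP Dcol] | [s ->]].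
  have /fin_all_exists[f Df] (i : 'I_n) :
      exists j, forall j', ((i, j') \in D) = (j' == j).
    have /cards1P[[i0 j] Di] := Drow i; exists j => j'.
    have /setP/(_ (i0, j)) := Di; rewrite !inE eqxx => /andP[_ /eqP /= i0E].
    by have /setP/(_ (i, j')) := Di; rewrite !inE eqxx andbT xpair_eqE i0E eqxx.
  have f_inj : injective f.
    move=> i1 i2 eq_f; have /cards1P[c Dc] := Dcol (f i1).
    have Dcf i : f i = f i1 -> (i, f i) = c.
      move=> fi; have /setP/(_ (i, f i)) := Dc; rewrite !inE Df fi !eqxx.
      by move/esym/eqP.
    by have [] : (i1, f i1) = (i2, f i2) by rewrite (Dcf i1) // (Dcf i2).
  exists (perm f_inj); apply/setP => -[i j].
  by rewrite in_perm_graph permE Df.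
split; apply/forallP => i; apply/cards1P.
  exists (i, s i); apply/setP => -[i' j]; rewrite !inE in_perm_graph xpair_eqE /=.
  by rewrite andbC; case: eqP => // ->.
exists ((s^-1)%g i, i); apply/setP => -[i' j].
rewrite !inE in_perm_graph xpair_eqE /= andbC.
case: (j =P i) => [-> | _]; rewrite ?andbF // !andbT.
by apply/eqP/eqP => ->; rewrite ?permK ?permKV.
Qed.

Lemma E_perm (n : nat) (L : 'M['I_n]_n) (i : nat) :
  E L i = #|[set s | #|symbols_of L s| == i]|.
Proof.
rewrite -(card_imset _ (@perm_graph_inj n)) /E; apply: eq_card => D.
have syms s : symbols_on L (perm_graph s) = symbols_of L s.
  by rewrite /symbols_on /perm_graph -imset_comp.
rewrite !inE; apply/andP/imsetP => [[/diagonalP[s ->]] | [s]].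
  by rewrite syms => ?; exists s; rewrite ?inE.
by rewrite inE => ? ->; split; [apply/diagonalP; exists s | rewrite syms].
Qed.

Lemma sum_E (n : nat) (L : 'M['I_n]_n) (P : pred nat) (a b : nat) :
    (forall s, P #|symbols_of L s| -> a <= #|symbols_of L s| < b) ->
  \sum_(a <= i < b | P i) E L i = #|[set s | P #|symbols_of L s|]|.
Proof.
move=> Pab.
transitivity (\sum_(a <= i < b | P i) \sum_s (#|symbols_of L s| == i : nat)).
  by apply: eq_bigr => i _; rewrite E_perm cardsE -sum1_card big_mkcond.
rewrite exchange_big cardsE -sum1_card [RHS]big_mkcond /=; apply: eq_bigr => s _.
rewrite unfold_in /=; case: ifP => Ps.
  rewrite big_mkcond.
  rewrite (bigD1_seq #|symbols_of L s|) ?mem_index_iota ?iota_uniq ?Pab //=.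
  rewrite Ps eqxx big1 // => i; rewrite eq_sym => /negbTE ->.
  by case: ifP.
by rewrite big1 // => i; case: eqP => // <-; rewrite Ps.
Qed.

(** * The count modulo 4 *)

Lemma odd_sqr_mod4 (m : nat) : odd m = m ^ 2 %[mod 4].
Proof.
rewrite -{2}(odd_double_half m) sqrnD -muln2 expnMn; case: (odd m); lia.
Qed.

Lemma sum_sym_even_offdiag (n : nat) (f : 'I_n -> 'I_n -> nat) :
    (forall a b, f a b = f b a) -> (forall a b, a != b -> ~~ odd (f a b)) ->
  \sum_a \sum_b f a b = \sum_a f a a %[mod 4].
Proof.
move=> f_sym f_even.
pose U := \sum_(a < n) \sum_(b < n | a < b) f a b.
have -> : \sum_a \sum_b f a b = \sum_a f a a + (U + U).
  have -> : U + U = U + \sum_(a < n) \sum_(b < n | b < a) f a b.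
    congr addn; rewrite /U (exchange_big_dep xpredT) //=.
    by apply: eq_bigr => b _; apply: eq_bigr => a _; apply: f_sym.
  rewrite -!big_split /=; apply: eq_bigr => a _.
  rewrite (bigD1 a) //=; congr addn.
  rewrite (bigID (fun b : 'I_n => a < b)) /=.
  congr addn; apply: eq_bigl => b; rewrite -val_eqE /=; lia.
have : ~~ odd U.
  rewrite /U; elim/big_ind: _ => // [x y | a _]; first by rewrite oddD => /negbTE ->.
  elim/big_ind: _ => // [x y | b lt_ab]; first by rewrite oddD => /negbTE ->.
  by apply: f_even; rewrite -val_eqE /= neq_ltn lt_ab.
lia.
Qed.

(** The square of the number of symbols missed by [s] is the number of pairs of
    symbols missed by [s]; double counting replaces the sum over [s] by a sum over
    pairs of symbols, in which only the diagonal terms survive modulo 4. *)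
Lemma card_odd_missing_mod4 (n : nat) (L : 'M['I_n]_n) :
    latin_square L -> ~~ odd n ->
  #|[set s | odd #|~: symbols_of L s|]| = n %[mod 4].
Proof.
move=> hL n_even.
pose p a b := #|[set s | (a \notin symbols_of L s) && (b \notin symbols_of L s)]|.
transitivity ((\sum_s #|~: symbols_of L s| ^ 2) %% 4).
  rewrite cardsE -sum1_card big_mkcond -[LHS]modn_summ -[RHS]modn_summ.
  congr modn; apply: eq_bigr => s _; rewrite -odd_sqr_mod4 unfold_in /=.
  by case: odd.
have -> : \sum_s #|~: symbols_of L s| ^ 2 = \sum_a \sum_b p a b.
  transitivity (\sum_s \sum_a \sum_b
      ((a \notin symbols_of L s) && (b \notin symbols_of L s) : nat)).
    apply: eq_bigr => s _.
    have -> : #|~: symbols_of L s| = \sum_a (a \notin symbols_of L s : nat).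
      by rewrite -sum1_card big_mkcond; apply: eq_bigr => a _; rewrite inE.
    rewrite -mulnn big_distrl; apply: eq_bigr => a _.
    by rewrite big_distrr; apply: eq_bigr => b _; rewrite /= mulnb.
  rewrite exchange_big; apply: eq_bigr => a _.
  rewrite exchange_big; apply: eq_bigr => b _.
  by rewrite /p cardsE -sum1_card [RHS]big_mkcond.
rewrite sum_sym_even_offdiag; last first.
- by move=> a b; apply: even_missing2.
- by move=> a b; apply: eq_card => s; rewrite !inE andbC.
under eq_bigr => a _.
  rewrite (_ : p a a = #|[set s : 'S_n | [forall i, s i != i]]|); first over.
  by rewrite -(card_missing1 a hL); apply: eq_card => s; rewrite !inE andbb.
rewrite sum_nat_const card_ord.
have := odd_derangements n_even; move: #|_| => d d_odd.
have -> : n * d = (n./2 * d./2) * 4 + n.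
  rewrite -{1 3}(odd_double_half n) -{1}(odd_double_half d) (negbTE n_even) d_odd.
  by rewrite -!muln2; lia.
by rewrite modnMDl.
Qed.

Theorem theorem39 (n : nat) (L : 'M['I_n]_n) (hL : latin_square L)
    (hn_even : ~~ odd n) (hn : 2 < n) :
  \sum_(1 <= i < n | odd i) E L i = \sum_(2 <= i < n.+1 | ~~ odd i) E L i %[mod 4]
  /\ \sum_(2 <= i < n.+1 | ~~ odd i) E L i = n %[mod 4].
Proof.
have le_n s : #|symbols_of L s| <= n by rewrite -[leqRHS]card_ord max_card.
have gt0 s : 0 < #|symbols_of L s|.
  pose i0 : 'I_n := Ordinal (ltnW (ltnW hn)).
  by apply/card_gt0P; exists (L i0 (s i0)); apply: imset_f.
rewrite !sum_E; last first.
- by move=> s s_odd; have := le_n s; have := gt0 s; lia.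
- by move=> s s_even; have := le_n s; have := gt0 s; lia.
have odd_n : #|[set s | odd #|symbols_of L s|]| = n %[mod 4].
  rewrite -(card_odd_missing_mod4 hL hn_even); congr modn; apply: eq_card => s.
  by rewrite !inE; have := cardsC (symbols_of L s); rewrite card_ord; lia.
have total : #|[set s | odd #|symbols_of L s|]|
    + #|[set s | ~~ odd #|symbols_of L s|]| = n`!.
  rewrite -card_Sn -(cardsC [set s | odd #|symbols_of L s|]).
  by congr addn; apply: eq_card => s; rewrite !inE.
have : 4 %| n`! by apply: dvdn_fact; lia.
by rewrite -total; lia.
Qed.
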